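(* Let $\mathcal G$ be a braided groupoid over a non-empty set $\mathcal P$. Let $\sigma:\mathcal G\,{}_{\mathfrak e}\times_{\mathfrak s}\mathcal G\to\mathcal G\,{}_{\mathfrak e}\times_{\mathfrak s}\mathcal G$ be the map $\sigma(f,g)=(f\rightharpoonup g,\,f\leftharpoonup g)$. Then $\sigma$ is a non-degenerate solution of the quiver-theoretical braid equation; i.e. $(\mathcal G,\sigma)$ is a non-degenerate braided quiver over $\mathcal P$.
   Context: A quiver over $\mathcal P$ is a set $\mathcal A$ with maps $\mathfrak s,\mathfrak e:\mathcal A\to\mathcal P$; $\mathcal A\,{}_{\mathfrak e}\times_{\mathfrak s}\mathcal B=\{(a,b):\mathfrak e(a)=\mathfrak s(b)\}$ with source $\mathfrak s(a)$ and end $\mathfrak e(b)$. A solution of the quiver-theoretical braid equation (braided quiver) is a pair $(\mathcal A,\sigma)$ with $\sigma$ an isomorphism of quivers from $\mathcal A\,{}_{\mathfrak e}\times_{\mathfrak s}\mathcal A$ to itself (over $\mathcal P$) with $(\sigma\times\mathrm{id})(\mathrm{id}\times\sigma)(\sigma\times\mathrm{id})=(\mathrm{id}\times\sigma)(\sigma\times\mathrm{id})(\mathrm{id}\times\sigma)$ on the triple fiber product. Writing $\sigma(x,y)=(x\rightharpoonup y,x\leftharpoonup y)$, it is non-degenerate if for every $x$ the maps $x\rightharpoonup\_:\mathfrak s^{-1}(\mathfrak e(x))\to\mathfrak s^{-1}(\mathfrak s(x))$ and $\_\leftharpoonup x:\mathfrak e^{-1}(\mathfrak s(x))\to\mathfrak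 e^{-1}(\mathfrak e(x))$ are bijections. Groupoids over $\mathcal P$: $fg$ is defined when $\mathfrak e(f)=\mathfrak s(g)$. A left action of $\mathcal G$ on $p:\mathcal E\to\mathcal P$ assigns $g\rightharpoonup e$ to $(g,e)$ with $\mathfrak e(g)=p(e)$, with $p(g\rightharpoonup e)=\mathfrak s(g)$, $g\rightharpoonup(h\rightharpoonup e)=gh\rightharpoonup e$, $\mathrm{id}\rightharpoonup e=e$; a right action assigns $e\leftharpoonup g$ to $(e,g)$ with $p(e)=\mathfrak s(g)$, with $p(e\leftharpoonup g)=\mathfrak e(g)$, $(e\leftharpoonup g)\leftharpoonup h=e\leftharpoonup gh$, $e\leftharpoonup\mathrm{id}=e$. A braided groupoid is a groupoid $\mathcal G$ over $\mathcal P$ with a left action $\rightharpoonup$ of $\mathcal G$ on $\mathfrak s:\mathcal G\to\mathcal P$ and a right action $\leftharpoonup$ of $\mathcal G$ on $\mathfrak e:\mathcal G\to\mathcal P$ such that $\mathfrak e(x\rightharpoonup g)=\mathfrak s(x\leftharpoonup g)$, $x\rightharpoonup fg=(x\rightharpoonup f)((x\leftharpoonup f)\rightharpoonup g)$, $xy\leftharpoonup g=(x\leftharpoonup(y\rightharpoonup g))(y\leftharpoonup g)$, and $fg=(f\rightharpoonup g)(f\leftharpoonup g)$ whenever the compositions make sense. *)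

(* Defs.v *)
From mathcomp Require Import ssreflect ssrfun ssrbool.

Set Implicit Arguments.
Unset Strict Implicit.
Unset Printing Implicit Defensive.

(* A partially defined operation is a function taking the proof of            *)
(* composability as an extra argument.  The laws of these operations are      *)
(* required for all proofs of the composability conditions occurring in them. *)

Record quiver (P : Type) := Quiver {
  arrow :> Type;
  src : arrow -> P;
  tgt : arrow -> P }.

Arguments src {P q} _.
Arguments tgt {P q} _.

Section Quivers.
Variable P : Type.

Definition is_quiver_hom (A B : quiver P) (f : A -> B) : Prop :=
  (forall a, src (f a) = src a) /\ (forall a, tgt (f a) = tgt a).

Record quiver_hom (A B : quiver P) := QuiverHom {
  qhom_fun :> A -> B;
  qhomP : is_quiver_hom qhom_fun }.

Definition is_quiver_iso (A B : quiver P) (f : quiver_hom A B) : Prop :=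
  exists g : quiver_hom B A, cancel f g /\ cancel g f.

Lemma qid_subproof (A : quiver P) : is_quiver_hom (fun a : A => a).
Proof. by split. Qed.

Definition qid (A : quiver P) : quiver_hom A A := QuiverHom (qid_subproof A).

Definition fprod (A B : quiver P) : quiver P :=
  @Quiver P {x : A * B | tgt x.1 = src x.2}
    (fun x => src (sval x).1) (fun x => tgt (sval x).2).

Definition fpair (A B : quiver P) (a : A) (b : B) (h : tgt a = src b) :
  fprod A B := exist _ (a, b) h.

Definition fst_arrow (A B : quiver P) (x : fprod A B) : A := (sval x).1.
Definition snd_arrow (A B : quiver P) (x : fprod A B) : B := (sval x).2.

Lemma fprodP (A B : quiver P) (x : fprod A B) :
  tgt (fst_arrow x) = src (snd_arrow x).
Proof. exact: svalP x. Qed.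

Section FprodMap.
Variables (A B A' B' : quiver P) (f : quiver_hom A A') (g : quiver_hom B B').

Lemma fprod_map_subproof (x : fprod A B) :
  tgt (f (fst_arrow x)) = src (g (snd_arrow x)).
Proof. by rewrite (qhomP f).2 (qhomP g).1 fprodP. Qed.

Definition fprod_map (x : fprod A B) : fprod A' B' :=
  fpair (fprod_map_subproof x).

End FprodMap.

Definition fprodA (A B C : quiver P) (x : fprod (fprod A B) C) :
    fprod A (fprod B C) :=
  @fpair A (fprod B C) (fst_arrow (fst_arrow x))
    (@fpair B C (snd_arrow (fst_arrow x)) (snd_arrow x) (fprodP x))
    (fprodP (fst_arrow x)).

Definition fprodAV (A B C : quiver P) (x : fprod A (fprod B C)) :
    fprod (fprod A B) C :=
  @fpair (fprod A B) C
    (@fpair A B (fst_arrow x) (fst_arrow (snd_arrow x)) (fprodP x))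
    (snd_arrow (snd_arrow x)) (fprodP (snd_arrow x)).

Section Braid.
Variables (A : quiver P) (sigma : quiver_hom (fprod A A) (fprod A A)).

(* The maps sigma x id and id x sigma, both on the triple fibre product       *)
(* A x (A x A).                                                               *)
Definition sigma12 (x : fprod A (fprod A A)) : fprod A (fprod A A) :=
  fprodA (fprod_map sigma (qid A) (fprodAV x)).

Definition sigma23 (x : fprod A (fprod A A)) : fprod A (fprod A A) :=
  fprod_map (qid A) sigma x.

Definition braid_equation : Prop :=
  forall x, sigma12 (sigma23 (sigma12 x)) = sigma23 (sigma12 (sigma23 x)).

Lemma left_map_subproof (x : A) (y : {a : A | src a = tgt x}) :
  src (fst_arrow (sigma (fpair (esym (svalP y))))) = src x.
Proof. exact: (qhomP sigma).1. Qed.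

Definition left_map (x : A) (y : {a : A | src a = tgt x}) :
    {a : A | src a = src x} :=
  exist _ (fst_arrow (sigma (fpair (esym (svalP y))))) (left_map_subproof y).

Lemma right_map_subproof (x : A) (y : {a : A | tgt a = src x}) :
  tgt (snd_arrow (sigma (fpair (svalP y)))) = tgt x.
Proof. exact: (qhomP sigma).2. Qed.

Definition right_map (x : A) (y : {a : A | tgt a = src x}) :
    {a : A | tgt a = tgt x} :=
  exist _ (snd_arrow (sigma (fpair (svalP y)))) (right_map_subproof y).

Definition nondegenerate : Prop :=
  forall x : A, bijective (@left_map x) /\ bijective (@right_map x).

End Braid.

Record braided_quiver (A : quiver P) (sigma : fprod A A -> fprod A A) : Prop :=
  BraidedQuiver {
    bq_hom : is_quiver_hom sigma;
    bq_iso : is_quiver_iso (QuiverHom bq_hom);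
    bq_braid : braid_equation (QuiverHom bq_hom) }.

Definition nondegenerate_braided_quiver (A : quiver P)
    (sigma : fprod A A -> fprod A A) : Prop :=
  exists h : braided_quiver sigma, nondegenerate (QuiverHom (bq_hom h)).

Unset Implicit Arguments.

Record groupoid := Groupoid {
  gquiver :> quiver P;
  gcomp : forall f g : gquiver, tgt f = src g -> gquiver;
  gid : P -> gquiver;
  ginv : gquiver -> gquiver;
  src_gcomp : forall f g h, src (gcomp f g h) = src f;
  tgt_gcomp : forall f g h, tgt (gcomp f g h) = tgt g;
  src_gid : forall p, src (gid p) = p;
  tgt_gid : forall p, tgt (gid p) = p;
  src_ginv : forall f, src (ginv f) = tgt f;
  tgt_ginv : forall f, tgt (ginv f) = src f;
  gcompA : forall f g k h1 h2 h3 h4,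
    gcomp f (gcomp g k h1) h2 = gcomp (gcomp f g h3) k h4;
  gcomp1f : forall f h, gcomp (gid (src f)) f h = f;
  gcompf1 : forall f h, gcomp f (gid (tgt f)) h = f;
  gcompVf : forall f h, gcomp (ginv f) f h = gid (tgt f);
  gcompfV : forall f h, gcomp f (ginv f) h = gid (src f) }.

Arguments gcomp {_} f g h : rename.
Arguments gid {_} p : rename.
Arguments ginv {_} f : rename.

Record left_action (G : groupoid) (E : Type) (p : E -> P) := LeftAction {
  lact :> forall (g : G) (e : E), tgt g = p e -> E;
  lact_anchor : forall g e h, p (lact g e h) = src g;
  lactM : forall g k e h1 h2 h3 h4,
    lact g (lact k e h1) h2 = lact (gcomp g k h3) e h4;
  lact1 : forall e h, lact (gid (p e)) e h = e }.

Record right_action (G : groupoid) (E : Type) (p : E -> P) := RightAction {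
  ract :> forall (e : E) (g : G), p e = src g -> E;
  ract_anchor : forall e g h, p (ract e g h) = tgt g;
  ractM : forall e g k h1 h2 h3 h4,
    ract (ract e g h1) k h2 = ract e (gcomp g k h3) h4;
  ract1 : forall e h, ract e (gid (p e)) h = e }.

Arguments lact {G E p} l g e h : rename.
Arguments ract {G E p} r e g h : rename.

Record braided_groupoid := BraidedGroupoid {
  bgroupoid :> groupoid;
  bl : left_action bgroupoid bgroupoid src;
  br : right_action bgroupoid bgroupoid tgt;
  bg_tgt_src : forall x g h, tgt (bl x g h) = src (br x g h);
  bl_comp : forall x f g h1 h2 h3 h4 h5,
    bl x (gcomp f g h1) h2 =
    gcomp (bl x f h3) (bl (br x f h3) g h4) h5;
  br_comp : forall x y g h1 h2 h3 h4 h5,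
    br (gcomp x y h1) g h2 =
    gcomp (br x (bl y g h3) h4) (br y g h3) h5;
  bg_comp : forall f g h1 h2,
    gcomp f g h1 = gcomp (bl f g h1) (br f g h1) h2 }.

Arguments bl {_}.
Arguments br {_}.
Arguments bg_tgt_src {_} x g h : rename.

Set Implicit Arguments.

Definition braiding (G : braided_groupoid) (x : fprod G G) : fprod G G :=
  let f := fst_arrow x in
  let g := snd_arrow x in
  let h := fprodP x in
  @fpair G G (bl f g h) (br f g h) (bg_tgt_src f g h).

End Quivers.

Arguments gcomp {P _} f g h : rename.
Arguments gid {P _} p : rename.
Arguments ginv {P _} f : rename.
Arguments lact {P G E p} l g e h : rename.
Arguments ract {P G E p} r e g h : rename.
Arguments bl {P} _.
Arguments br {P} _.

(* Main.v *)
From mathcomp Require Import ssreflect ssrfun ssrbool.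
From Stdlib Require Import ProofIrrelevance.
Require Import Defs.

(** Write [tau (a, b) = (b^-1, a^-1)], an involution.  The laws of a braided
    groupoid give [sigma tau sigma = tau], so [tau sigma tau] is a two-sided
    inverse of [sigma].  In the braid equation the outer components agree
    because [fg = (f -> g)(f <- g)] and both operations are actions; the middle
    ones agree after multiplication on the right by the last component, where
    both sides become [xy <- z], and right multiplication is cancellable. *)

Set Implicit Arguments.
Unset Strict Implicit.
Unset Printing Implicit Defensive.

(** * Independence of pairs and operations from the composability proofs *)

Section Irrelevance.
Variable P : Type.

Lemma fprod_eq (A B : quiver P) (x y : fprod A B) :
  fst_arrow x = fst_arrow y -> snd_arrow x = snd_arrow y -> x = y.
Proof.
case: x y => [[a b] h] [[a' b'] h']; rewrite /fst_arrow /snd_arrow /= => e1 e2.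
by subst; congr (exist _ _ _); apply: proof_irrelevance.
Qed.

Lemma sval_eq (T : Type) (Q : T -> Prop) (x y : {t | Q t}) :
  sval x = sval y -> x = y.
Proof.
case: x y => [a h] [b h'] /= e; subst.
by congr (exist _ _ _); apply: proof_irrelevance.
Qed.

Lemma gcomp_congr (G : groupoid P) (f f' g g' : G) h h' :
  f = f' -> g = g' -> gcomp f g h = gcomp f' g' h'.
Proof. by move=> e1 e2; subst; congr gcomp; apply: proof_irrelevance. Qed.

Lemma lact_congr (G : groupoid P) (E : Type) (p : E -> P)
    (l : left_action P G E p) g g' e e' h h' :
  g = g' -> e = e' -> lact l g e h = lact l g' e' h'.
Proof. by move=> e1 e2; subst; congr lact; apply: proof_irrelevance. Qed.

Lemma ract_congr (G : groupoid P) (E : Type) (p : E -> P)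
    (r : right_action P G E p) e e' g g' h h' :
  e = e' -> g = g' -> ract r e g h = ract r e' g' h'.
Proof. by move=> e1 e2; subst; congr ract; apply: proof_irrelevance. Qed.

End Irrelevance.

(** Collected for rewriting: most composability conditions below follow by computing both ends. *)
Definition gends := (src_gcomp, tgt_gcomp, src_gid, tgt_gid, src_ginv, tgt_ginv,
  lact_anchor, ract_anchor).

(** * Cancellation and inverses in a groupoid and its actions *)

Section Groupoid.
Variables (P : Type) (G : groupoid P).
Implicit Types f g k : G.

Lemma gcompK f g (h : tgt f = src g) h' :
  gcomp (gcomp f g h) (ginv g) h' = f.
Proof.
have h1 : tgt g = src (ginv g) by rewrite gends.
have h2 : tgt f = src (gcomp g (ginv g) h1) by rewrite gends.
rewrite -(gcompA _ _ _ _ _ h1 h2) -[RHS](gcompf1 _ _ f (esym (src_gid _ _ _))).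
by apply: gcomp_congr; rewrite // gcompfV h.
Qed.

Lemma gcomp_injr f f' g (h : tgt f = src g) (h' : tgt f' = src g) :
  gcomp f g h = gcomp f' g h' -> f = f'.
Proof.
have hg k (hk : tgt k = src g) : tgt (gcomp k g hk) = src (ginv g).
  by rewrite !gends.
move=> e; rewrite -(gcompK (hg _ h)) -(gcompK (hg _ h')).
exact: gcomp_congr.
Qed.

Lemma gcomp_eq_id_invr f g (h : tgt f = src g) :
  gcomp f g h = gid (tgt g) -> f = ginv g.
Proof.
have h' : tgt (ginv g) = src g by rewrite gends.
by rewrite -(gcompVf _ _ g h') => /gcomp_injr.
Qed.

(** Right cancellation of [f] in [f f = id f]. This serves to recognise identities among the values
    of the two actions. *)
Lemma gcomp_idem f (h : tgt f = src f) : gcomp f f h = f -> f = gid (src f).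
Proof.
have h' : tgt (gid (src f) : G) = src f by rewrite gends.
by move=> e; apply: (@gcomp_injr _ _ _ h h'); rewrite e gcomp1f.
Qed.

Lemma ginvK f : ginv (ginv f) = f.
Proof.
have h : tgt f = src (ginv f) by rewrite gends.
by rewrite -(@gcomp_eq_id_invr f (ginv f) h) // gcompfV gends.
Qed.

Lemma gcomp_eq_id_inv f g (h : tgt f = src g) :
  gcomp f g h = gid (src f) -> g = ginv f.
Proof.
move=> e.
(* Comparing ends in [e] shows that the identity on its right is also the one at the end of [g]. *)
have hg : tgt g = src f by rewrite -(tgt_gcomp _ _ f g h) e gends.
by move: e; rewrite -hg => /gcomp_eq_id_invr ->; rewrite ginvK.
Qed.

Lemma lactVK (E : Type) (p : E -> P) (l : left_action P G E p) f e
    (h : tgt f = p e) h' :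
  lact l (ginv f) (lact l f e h) h' = e.
Proof.
have h1 : tgt (ginv f) = src f by rewrite gends.
have h2 : tgt (gcomp (ginv f) f h1) = p e by rewrite !gends.
have h3 : tgt (gid (p e) : G) = p e by rewrite gends.
rewrite (lactM _ _ _ _ _ _ _ _ _ _ h1 h2) -[RHS](lact1 _ _ _ _ l e h3).
by apply: lact_congr; rewrite // gcompVf h.
Qed.

Lemma lactKV (E : Type) (p : E -> P) (l : left_action P G E p) f e
    (h : tgt (ginv f) = p e) h' :
  lact l f (lact l (ginv f) e h) h' = e.
Proof.
have h1 : tgt (ginv (ginv f)) = p (lact l (ginv f) e h) by rewrite !gends.
by rewrite -[RHS](lactVK h1); apply: lact_congr; rewrite ?ginvK.
Qed.

Lemma ractK (E : Type) (p : E -> P) (r : right_action P G E p) e f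
    (h : p e = src f) h' :
  ract r (ract r e f h) (ginv f) h' = e.
Proof.
have h1 : tgt f = src (ginv f) by rewrite gends.
have h2 : p e = src (gcomp f (ginv f) h1) by rewrite !gends.
have h3 : p e = src (gid (p e) : G) by rewrite gends.
rewrite (ractM _ _ _ _ _ _ _ _ _ _ h1 h2) -[RHS](ract1 _ _ _ _ r e h3).
by apply: ract_congr; rewrite // gcompfV h.
Qed.

Lemma ractVK (E : Type) (p : E -> P) (r : right_action P G E p) e f
    (h : p e = src (ginv f)) h' :
  ract r (ract r e (ginv f) h) f h' = e.
Proof.
have h1 : p (ract r e (ginv f) h) = src (ginv (ginv f)) by rewrite !gends.
by rewrite -[RHS](ractK h1); apply: ract_congr; rewrite ?ginvK.
Qed.

End Groupoid.

(** * Identities and inverses under the two actions of a braided groupoid *)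

Section BraidedGroupoid.
Variables (P : Type) (G : braided_groupoid P).
Implicit Types f g x y z : G.

(** With [i] the identity, [i = i i] and [x <- i = x], so [bl_comp] gives
    [x -> i = (x -> i)(x -> i)], and an idempotent is an identity. *)
Lemma bl_id x h : bl G x (gid (tgt x)) h = gid (src x).
Proof.
set i : G := gid (tgt x).
have hi : tgt i = src i by rewrite !gends.
have rx : br G x i h = x by apply: ract1.
have hl : tgt (bl G x i h) = src (bl G x i h).
  by rewrite bg_tgt_src rx gends.
have hii : tgt x = src (gcomp i i hi) by rewrite !gends.
have hr : tgt (br G x i h) = src i by rewrite rx.
have hb : tgt (bl G x i h) = src (bl G (br G x i h) i hr).
  by rewrite bg_tgt_src gends.
have := bl_comp _ _ x i i hi hii h hr hb.
have -> : bl G x (gcomp i i hi) hii = bl G x i h.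
  apply: lact_congr => //.
  rewrite -[RHS](gcompf1 _ _ i (esym (src_gid _ _ _))).
  by apply: gcomp_congr; rewrite // gends.
have -> : gcomp (bl G x i h) (bl G (br G x i h) i hr) hb =
          gcomp (bl G x i h) (bl G x i h) hl.
  by apply: gcomp_congr => //; apply: lact_congr.
by move/esym/gcomp_idem => ->; rewrite gends.
Qed.

(** The mirror argument: [i -> g = g] and [br_comp] make [i <- g] idempotent. *)
Lemma br_id g h : br G (gid (src g)) g h = gid (tgt g).
Proof.
set i : G := gid (src g).
have hi : tgt i = src i by rewrite !gends.
have lg : bl G i g h = g by apply: lact1.
have hr : tgt (br G i g h) = src (br G i g h).
  by rewrite -bg_tgt_src lg gends.
have hii : tgt (gcomp i i hi) = src g by rewrite !gends.
have hl : tgt i = src (bl G i g h) by rewrite lg.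
have hb : tgt (br G i (bl G i g h) hl) = src (br G i g h).
  by rewrite -bg_tgt_src !gends.
have := br_comp _ _ i i g hi hii h hl hb.
have -> : br G (gcomp i i hi) g hii = br G i g h.
  apply: ract_congr => //.
  rewrite -[RHS](gcompf1 _ _ i (esym (src_gid _ _ _))).
  by apply: gcomp_congr; rewrite // gends.
have -> : gcomp (br G i (bl G i g h) hl) (br G i g h) hb =
          gcomp (br G i g h) (br G i g h) hr.
  by apply: gcomp_congr => //; apply: ract_congr.
by move/esym/gcomp_idem => ->; rewrite -bg_tgt_src lg.
Qed.

(** By [bl_comp], [(x -> g)((x <- g) -> g^-1) = x -> g g^-1], which is an identity by [bl_id]. *)
Lemma bl_inv x g (h : tgt x = src g) h' :
  bl G (br G x g h) (ginv g) h' = ginv (bl G x g h).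
Proof.
have hg : tgt g = src (ginv g) by rewrite gends.
have hx : tgt x = src (gcomp g (ginv g) hg) by rewrite gends.
have hb : tgt (bl G x g h) = src (bl G (br G x g h) (ginv g) h').
  by rewrite bg_tgt_src gends.
apply: (@gcomp_eq_id_inv _ _ _ _ hb).
rewrite -(bl_comp _ _ _ _ _ hg hx) gends -(bl_id (esym (src_gid _ _ _))).
by apply: lact_congr; rewrite // gcompfV h.
Qed.

(** Dually, expand [x^-1 x <- g] with [br_comp]. *)
Lemma br_inv x g (h : tgt x = src g) h' :
  br G (ginv x) (bl G x g h) h' = ginv (br G x g h).
Proof.
have hx : tgt (ginv x) = src x by rewrite gends.
have hg : tgt (gcomp (ginv x) x hx) = src g by rewrite gends.
have hb : tgt (br G (ginv x) (bl G x g h) h') = src (br G x g h).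
  by rewrite -bg_tgt_src gends.
apply: (@gcomp_eq_id_invr _ _ _ _ hb).
rewrite -(br_comp _ _ _ _ _ hx hg) gends -(br_id (tgt_gid _ _ _)).
by apply: ract_congr; rewrite // gcompVf h.
Qed.

(** * The braiding as an isomorphism of quivers *)

Lemma braiding_hom : is_quiver_hom (@braiding P G).
Proof. by split=> x; [apply: lact_anchor | apply: ract_anchor]. Qed.

(** The involution [tau]; swapping the factors makes their inverses composable. *)
Definition fprod_inv (x : fprod G G) : fprod G G :=
  @fpair P G G (ginv (snd_arrow x)) (ginv (fst_arrow x))
    (etrans (tgt_ginv _ _ _) (etrans (esym (fprodP x)) (esym (src_ginv _ _ _)))).

Lemma fprod_invK (x : fprod G G) : fprod_inv (fprod_inv x) = x.
Proof. by apply: fprod_eq; rewrite /fprod_inv /fst_arrow /snd_arrow /= ginvK. Qed.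

(** Put [u = f -> g] and [v = f <- g]. Then [u^-1 = v -> g^-1] by [bl_inv], so
    [v^-1 -> u^-1 = g^-1]; likewise [v^-1 = f^-1 <- u] by [br_inv], so [v^-1 <- u^-1 = f^-1]. *)
Lemma braiding_inv (x : fprod G G) : braiding (fprod_inv (braiding x)) = fprod_inv x.
Proof.
case: x => -[f g] /= h.
apply: fprod_eq.
- rewrite /braiding /fprod_inv /fst_arrow /snd_arrow /=.
  have h1 : tgt (br G f g h) = src (ginv g) by rewrite !gends.
  have h2 : tgt (ginv (br G f g h)) = src (bl G (br G f g h) (ginv g) h1).
    by rewrite !gends.
  rewrite -[RHS](lactVK h2); apply: lact_congr; first congr ginv.
  + exact: ract_congr.
  + by rewrite bl_inv; congr ginv; apply: lact_congr.
- rewrite /braiding /fprod_inv /fst_arrow /snd_arrow /=.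
  have h1 : tgt (ginv f) = src (bl G f g h) by rewrite !gends.
  have h2 : tgt (br G (ginv f) (bl G f g h) h1) = src (ginv (bl G f g h)).
    by rewrite !gends.
  rewrite -[RHS](ractK h2); apply: ract_congr; last congr ginv.
  + by rewrite br_inv; congr ginv; apply: ract_congr.
  + exact: lact_congr.
Qed.

Lemma braiding_iso : is_quiver_iso (QuiverHom braiding_hom).
Proof.
have inv_hom : is_quiver_hom (fun x : fprod G G => fprod_inv (braiding (fprod_inv x))).
  by split=> x; rewrite /= /fst_arrow /snd_arrow /= !gends.
by exists (QuiverHom inv_hom); split=> x /=; rewrite braiding_inv fprod_invK.
Qed.

(** * The braid equation and non-degeneracy *)

Lemma braiding_braid : braid_equation (QuiverHom braiding_hom).
Proof.
case=> -[x [[y z] hyz0]] hxy0; have hyz : tgt y = src z := hyz0.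
have hxy : tgt x = src y := hxy0.
have hbxy : tgt (bl G x y hxy) = src (br G x y hxy) by apply: bg_tgt_src.
have hbyz : tgt (bl G y z hyz) = src (br G y z hyz) by apply: bg_tgt_src.
have h_xy_z : tgt (br G x y hxy) = src z by rewrite gends.
have h_x_yz : tgt x = src (bl G y z hyz) by rewrite gends.
have hz : tgt (gcomp x y hxy) = src z by rewrite gends.
have hyzc : tgt x = src (gcomp y z hyz) by rewrite gends.
have hz' : tgt (gcomp (bl G x y hxy) (br G x y hxy) hbxy) = src z by rewrite !gends.
have hyzc' : tgt x = src (gcomp (bl G y z hyz) (br G y z hyz) hbyz) by rewrite !gends.
have h1 : tgt (bl G x y hxy) = src (bl G (br G x y hxy) z h_xy_z).
  by rewrite gends.
have h2 : tgt (br G x (bl G y z hyz) h_x_yz) = src (br G y z hyz).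
  by rewrite gends.
(* Both sides are [xy -> z], with [xy] factored in two ways. *)
have first : bl G (bl G x y hxy) (bl G (br G x y hxy) z h_xy_z) h1 =
             bl G x (bl G y z hyz) h_x_yz.
  rewrite (lactM _ _ _ _ _ _ _ _ _ _ hbxy hz') (lactM _ _ _ _ _ _ _ _ _ _ hxy hz).
  by apply: lact_congr; rewrite // -bg_comp.
(* Both sides are [x <- yz]. *)
have last : br G (br G x y hxy) z h_xy_z =
            br G (br G x (bl G y z hyz) h_x_yz) (br G y z hyz) h2.
  rewrite (ractM _ _ _ _ _ _ _ _ _ _ hbyz hyzc') (ractM _ _ _ _ _ _ _ _ _ _ hyz hyzc).
  by apply: ract_congr; rewrite // -bg_comp.
have middle : br G (bl G x y hxy) (bl G (br G x y hxy) z h_xy_z) h1 =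
              bl G (br G x (bl G y z hyz) h_x_yz) (br G y z hyz) h2.
  have hc : tgt (br G (bl G x y hxy) (bl G (br G x y hxy) z h_xy_z) h1) =
            src (br G (br G x y hxy) z h_xy_z).
    by rewrite gends bg_tgt_src.
  (* The right-hand side is composable with the same last component only thanks to [last]. *)
  have hd : tgt (bl G (br G x (bl G y z hyz) h_x_yz) (br G y z hyz) h2) =
            src (br G (br G x y hxy) z h_xy_z).
    by rewrite last bg_tgt_src.
  apply: (@gcomp_injr _ _ _ _ _ hc hd).
  rewrite -(br_comp _ _ _ _ _ hbxy hz').
  transitivity (br G (gcomp x y hxy) z hz); first by apply: ract_congr; rewrite // -bg_comp.
  rewrite (br_comp _ _ _ _ _ hxy hz hyz h_x_yz h2) (bg_comp _ _ _ _ h2 (bg_tgt_src _ _ _ _ h2)).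
  exact: gcomp_congr.
apply: fprod_eq; last apply: fprod_eq;
  rewrite /sigma12 /sigma23 /fst_arrow /snd_arrow /=.
(* In each component the remaining discrepancies are composability proofs. *)
- by apply: etrans (etrans first _);
    repeat (reflexivity || apply: lact_congr || apply: ract_congr).
- by apply: etrans (etrans middle _);
    repeat (reflexivity || apply: lact_congr || apply: ract_congr).
- by apply: etrans (etrans last _);
    repeat (reflexivity || apply: lact_congr || apply: ract_congr).
Qed.

(** Only the action laws matter: the inverse of acting by [x], on either side, is acting by
    [x^-1]. *)
Lemma braiding_nondegenerate : nondegenerate (QuiverHom braiding_hom).
Proof.
move=> x; split.
- have hinv (u : {a : G | src a = src x}) : tgt (ginv x) = src (sval u).
    by rewrite gends (svalP u).
  have hsrc (u : {a : G | src a = src x}) : src (bl G (ginv x) (sval u) (hinv u)) = tgt x by rewrite !gends.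
  exists (fun u => exist (fun a : G => src a = tgt x) _ (hsrc u)) => u; apply: sval_eq => /=.
  + exact: lactVK.
  + exact: lactKV.
- have hinv (u : {a : G | tgt a = tgt x}) : tgt (sval u) = src (ginv x).
    by rewrite gends (svalP u).
  have htgt (u : {a : G | tgt a = tgt x}) : tgt (br G (sval u) (ginv x) (hinv u)) = src x by rewrite !gends.
  exists (fun u => exist (fun a : G => tgt a = src x) _ (htgt u)) => u; apply: sval_eq => /=.
  + exact: ractK.
  + exact: ractVK.
Qed.

End BraidedGroupoid.

Theorem lemma2p11 (P : Type) (hP : inhabited P) (G : braided_groupoid P) :
  nondegenerate_braided_quiver (@braiding P G).
Proof.
exists (BraidedQuiver (braiding_iso G) (@braiding_braid _ G)).
exact: braiding_nondegenerate.
Qed.
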